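(* For every positive integer $n$, the $n\times n$ matrix $M_n$ defined by $$M_n(i,j)=(i-j)^2,\qquad 1\le i,j\le n,$$ satisfies $$\operatorname{rank}_+(M_n)\;\le\;2+\Big\lceil\frac n2\Big\rceil .$$
   Context: For an entrywise nonnegative matrix $M\in\mathbb{R}^{m\times n}_+$, the nonnegative rank $\operatorname{rank}_+(M)$ is the minimum $k$ such that there exist entrywise nonnegative $U\in\mathbb{R}^{m\times k}_+$, $V\in\mathbb{R}^{k\times n}_+$ with $M=UV$. *)

(* Defs.v *)
From HB Require Import structures.
From mathcomp Require Import all_boot all_order all_algebra.
From mathcomp Require Import boolp reals.

Set Implicit Arguments.
Unset Strict Implicit.
Unset Printing Implicit Defensive.

Import Order.TTheory GRing.Theory Num.Theory.
Local Open Scope ring_scope.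

Definition has_nonneg_factorization (R : realType) (m n : nat)
    (M : 'M[R]_(m, n)) (k : nat) : Prop :=
  exists (U : 'M[R]_(m, k)) (V : 'M[R]_(k, n)),
    [/\ U \is a mxOver Num.nneg, V \is a mxOver Num.nneg & M = U *m V].

Lemma ex_nonneg_factorization (R : realType) (m n : nat) (M : 'M[R]_(m, n)) :
  M \is a mxOver Num.nneg -> exists k, `[< has_nonneg_factorization M k >].
Proof.
move=> M_ge0; exists n; apply/asboolP; exists M, 1%:M; split => //.
  by apply/mxOverP => i j; rewrite !mxE nnegrE ler0n.
by rewrite mulmx1.
Qed.

(* The least inner dimension k of a nonnegative factorization; k = 0 is allowed,
   so that the zero matrix has nonnegative rank 0. *)
Definition nonneg_rank (R : realType) (m n : nat) (M : 'M[R]_(m, n))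
    (M_ge0 : M \is a mxOver Num.nneg) : nat :=
  ex_minn (ex_nonneg_factorization M_ge0).

(* The rows and columns are indexed from 0 instead of 1, which does not change
   the differences i - j (taken in R, not truncated). *)
Definition sqdiff_mx (R : realType) (n : nat) : 'M[R]_n :=
  \matrix_(i < n, j < n) (i%:R - j%:R) ^+ 2.

Lemma sqdiff_mx_ge0 (R : realType) (n : nat) :
  sqdiff_mx R n \is a mxOver Num.nneg.
Proof. by apply/mxOverP => i j; rewrite mxE nnegrE sqr_ge0. Qed.

(* Main.v *)
(** The idea: centre the points at x_i = i - (n - 1) / 2, so that the absolute
    values |x_i| take only uphalf n distinct values. Then
      (x_i - x_j)^2 = (|x_i| - |x_j|)^2 + 4 (x_i^+ x_j^- + x_i^- x_j^+),
    where the last term is a sum of two nonnegative matrices of rank one, and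
    the first has at most uphalf n distinct rows. *)
Require Import Defs.
From mathcomp Require Import all_boot all_order all_algebra.
From mathcomp Require Import boolp reals.
From mathcomp Require Import zify ring lra.

Import Order.TTheory GRing.Theory Num.Theory.
Local Open Scope ring_scope.

(** The difference of the two squares is [2 (|x| |y| - x y)], which is [4 |x| |y|] for opposite
    signs and [0] otherwise. *)
Lemma sqrB_posneg (R : realDomainType) (x y : R) :
  (x - y) ^+ 2 = (2 * Num.max x 0) * (2 * Num.max (- y) 0)
               + (2 * Num.max (- x) 0) * (2 * Num.max y 0)
               + (`|x| - `|y|) ^+ 2.
Proof.
rewrite !maxEle oppr_le0.
by case: (ger0P x) => hx; case: (ger0P y) => hy;
   do ![case: ifP => ?]; try lra; nra.
Qed.

Lemma sqdist_nonneg_factorization (R : realType) (n h : nat)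
    (x : 'I_n -> R) (y : 'I_h -> R) (f : 'I_n -> 'I_h) :
  (forall i, `|x i| = y (f i)) ->
  has_nonneg_factorization (\matrix_(i, j) (x i - x j) ^+ 2) (2 + h).
Proof.
move=> xf.
pose U1 : 'M[R]_(n, 2) :=
  \matrix_(i, k) (2 * Num.max (if k == 0 then x i else - x i) 0).
pose V1 : 'M[R]_(2, n) :=
  \matrix_(k, j) (2 * Num.max (if k == 0 then - x j else x j) 0).
(* Row [i] of [U2] selects row [f i] of [V2], where [y (f i)] is [|x i|]. *)
pose U2 : 'M[R]_(n, h) := \matrix_(i, k) (f i == k)%:R.
pose V2 : 'M[R]_(h, n) := \matrix_(k, j) (y k - `|x j|) ^+ 2.
exists (row_mx U1 U2), (col_mx V1 V2); split.
- apply/mxOverP => i k; rewrite mxE nnegrE.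
  case: split => {}k; rewrite mxE ?ler0n //.
  by rewrite mulr_ge0 // le_max lexx orbT.
- apply/mxOverP => k j; rewrite mxE nnegrE.
  case: split => {}k; rewrite mxE ?sqr_ge0 //.
  by rewrite mulr_ge0 // le_max lexx orbT.
- apply/matrixP => i j; rewrite mul_row_col !mxE sqrB_posneg.
  rewrite !big_ord_recl big_ord0 addr0 !mxE /= (bigD1 (f i)) //= !mxE eqxx mul1r.
  rewrite -xf big1 ?addr0 // => k /negPf fk.
  by rewrite !mxE eq_sym fk mul0r.
Qed.

(* uphalf n is n / 2 rounded up. *)
Theorem theorem9 (R : realType) (n : nat) (n_gt0 : (0 < n)%N) :
  (nonneg_rank (sqdiff_mx_ge0 R n) <= 2 + uphalf n)%N.
Proof.
rewrite /nonneg_rank; case: ex_minnP => r _; apply; apply/asboolP.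
pose x (k : nat) : R := k%:R - n.-1%:R / 2.
(* The reflection of [i] to [n.-1 - i] negates [x], so the smaller of the two indices can represent
   their common absolute value. *)
have fold_lt (i : 'I_n) : (minn i (n.-1 - i) < uphalf n)%N.
  by have := ltn_ord i; lia.
have -> : sqdiff_mx R n = \matrix_(i, j) (x i - x j) ^+ 2.
  by apply/matrixP => i j; rewrite !mxE /x; congr (_ ^+ 2); ring.
apply: (@sqdist_nonneg_factorization _ _ _ (fun i => x i)
          (fun k => `|x k|) (fun i => Ordinal (fold_lt i))) => i /=.
rewrite /minn; case: ifP => // _.
rewrite -normrN /x natrB; last by rewrite -ltnS prednK.
by congr `|_|; field.
Qed.
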